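(* For $\mu>0$ let $\lambda_D,\lambda_R,\lambda_N,\lambda_{\tilde N}$ be eigenvalues of the Dirichlet, Robin, Neumann and regional Neumann problems whose eigenfunctions are functions attaining the minimization levels $\Lambda_D,\Lambda_R,\Lambda_N,\Lambda_{\tilde N}$ (see context), respectively. Then $\lambda_D$, $\lambda_R$, $\lambda_N$, $\lambda_{\tilde N}$ are bounded below by a positive constant independent of $\mu$.
   Context: Let $s\in(0,1)$, let $\Omega\subset\mathbb{R}^n$ be a bounded open set with $C^{0,1}$ boundary, $\Omega^c=\mathbb{R}^n\setminus\Omega$, and let $\beta\in L^\infty(\mathbb{R}^n\setminus\Omega)$ be strictly positive. $G\colon[0,\infty)\to[0,\infty)$ is a Young function: $G(t)=\int_0^t g(\tau)\,d\tau$, with $g$ right continuous and nondecreasing, $g(0)=0$, $g(t)>0$ for $t>0$, $\lim_{t\to\infty}g(t)=\infty$, and $g=G'$. It satisfies: $1<p^-\leq \frac{tg(t)}{G(t)}\leq p^+<\infty$ for all $t>0$, for fixed constants $p^\pm$; $t\mapsto G(\sqrt t)$ is convex on $[0,\infty)$; $\int_0^1 \frac{G^{-1}(\tau)}{\tau^{(n+s)/n}}d\tau<\infty$ and $\int_1^\infty \frac{G^{-1}(\tau)}{\tau^{(n+s)/n}}d\tau=\infty$. Notation: $D_su(x,y)=\frac{u(x)-u(y)}{|x-y|^s}$, $d\mu=\frac{dx\,dy}{|x-y|^n}$ (unrelated to the number $\mu$); $g(|r|)\frac{r}{|r|}$ is read as $0$ when $r=0$. Modulars: $\Phi_{G,\Omega}(u)=\int_\Omega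 G(|u|)\,dx$, $\Phi_{s,G,\mathbb{R}^n}(u)=\iint_{\mathbb{R}^n\times\mathbb{R}^n}G(|D_su|)\,d\mu$, $\Phi_{s,G,\Omega}(u)=\iint_{\Omega\times\Omega}G(|D_su|)\,d\mu$, $\Phi_{s,G,*}(u)=\iint_{\mathbb{R}^{2n}\setminus(\Omega^c)^2}G(|D_su|)\,d\mu$, $\Phi_{G,\beta,\Omega^c}(u)=\int_{\mathbb{R}^n\setminus\Omega}\beta\,G(|u|)\,dx$. Spaces (of measurable functions): $W^{s,G}_0(\Omega)=\{u\colon\mathbb{R}^n\to\mathbb{R}: \int_{\mathbb{R}^n}G(|u|)\,dx<\infty,\ \Phi_{s,G,\mathbb{R}^n}(u)<\infty,\ u=0 \text{ a.e. in }\mathbb{R}^n\setminus\Omega\}$; $W^{s,G}_*(\Omega)=\{u\colon\mathbb{R}^n\to\mathbb{R}: \Phi_{G,\Omega}(u)<\infty,\ \Phi_{s,G,*}(u)<\infty\}$; $W^{s,G}_{reg}(\Omega)=\{u\colon\Omega\to\mathbb{R}: \Phi_{G,\Omega}(u)<\infty,\ \Phi_{s,G,\Omega}(u)<\infty\}$; $\mathcal{X}=\{u\in W^{s,G}_*(\Omega): \Phi_{G,\beta,\Omega^c}(u)<\infty\}$. For $\mu>0$: $\Lambda_D=\inf\left\{\frac{\Phi_{s,G,\mathbb{R}^n}(u)+\Phi_{G,\Omega}(u)}{\Phi_{G,\Omega}(u)}: u\in W^{s,G}_0(\Omega),\ \Phi_{G,\Omega}(u)=\mu\right\}$, $\Lambda_N=\inf\left\{\frac{\Phi_{s,G,*}(u)+\Phi_{G,\Omega}(u)}{\Phi_{G,\Omega}(u)}: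 u\in W^{s,G}_*(\Omega),\ \Phi_{G,\Omega}(u)=\mu\right\}$, $\Lambda_{\tilde N}=\inf\left\{\frac{\Phi_{s,G,\Omega}(u)+\Phi_{G,\Omega}(u)}{\Phi_{G,\Omega}(u)}: u\in W^{s,G}_{reg}(\Omega),\ \Phi_{G,\Omega}(u)=\mu\right\}$, $\Lambda_R=\inf\left\{\frac{\Phi_{s,G,*}(u)+\Phi_{G,\Omega}(u)+\Phi_{G,\beta,\Omega^c}(u)}{\Phi_{G,\Omega}(u)}: u\in\mathcal{X},\ \Phi_{G,\Omega}(u)=\mu\right\}$. Forms: $\langle(-\Delta_g)^su,v\rangle$, $\langle(-\Delta_g)_\Omega^su,v\rangle$ and $\langle(-\Delta_g)^su,v\rangle_*$ denote $\iint_E g(|D_su|)\frac{D_su}{|D_su|}D_sv\,d\mu$ with $E=\mathbb{R}^n\times\mathbb{R}^n$, $E=\Omega\times\Omega$ and $E=\mathbb{R}^{2n}\setminus(\Omega^c)^2$, respectively. Eigenvalues: $\lambda$ is an eigenvalue with eigenfunction $u$ of - the Dirichlet problem if $u\in W^{s,G}_0(\Omega)$ and $\langle(-\Delta_g)^su,v\rangle=(\lambda-1)\int_\Omega g(|u|)\frac{u}{|u|}v\,dx$ for all $v\in W^{s,G}_0(\Omega)$; - the Neumann problem if $u\in W^{s,G}_*(\Omega)$ and $\langle(-\Delta_g)^su,v\rangle_*=(\lambda-1)\int_\Omega g(|u|)\frac{u}{|u|}v\,dx$ for all $v\in W^{s,G}_*(\Omega)$; - the regional Neumann problem if $u\in W^{s,G}_{reg}(\Omega)$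 and $\langle(-\Delta_g)_\Omega^su,v\rangle=(\lambda-1)\int_\Omega g(|u|)\frac{u}{|u|}v\,dx$ for all $v\in W^{s,G}_{reg}(\Omega)$; - the Robin problem if $u\in\mathcal{X}$ and $\langle(-\Delta_g)^su,v\rangle_*=(\lambda-1)\int_\Omega g(|u|)\frac{u}{|u|}v\,dx-\int_{\mathbb{R}^n\setminus\Omega}\beta\,g(|u|)\frac{u}{|u|}v\,dx$ for all $v\in\mathcal{X}$. *)

(* Defs.v *)
From HB Require Import structures.
From mathcomp Require Import all_boot all_order all_algebra.
From mathcomp Require Import all_classical all_reals all_analysis.
Set Implicit Arguments.
Unset Strict Implicit.
Unset Printing Implicit Defensive.
Import Order.TTheory GRing.Theory Num.Theory.
Import numFieldNormedType.Exports.
Local Open Scope classical_set_scope.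
Local Open Scope ring_scope.

Definition rV_display : measure_display -> measure_display.
Proof. exact. Qed.

Section measurable_rV.
Context (R : realType) (n : nat).

Let coors : 'I_n -> 'rV[R]_n -> measurableTypeR R := fun i x => x ord0 i.

Let rV_set0 : g_sigma_preimage coors set0.
Proof. exact: sigma_algebra0. Qed.

Let rV_setC A : g_sigma_preimage coors A -> g_sigma_preimage coors (~` A).
Proof. exact: sigma_algebraC. Qed.

Let rV_bigcup (F : _^nat) : (forall i, g_sigma_preimage coors (F i)) ->
  g_sigma_preimage coors (\bigcup_i (F i)).
Proof. exact: sigma_algebra_bigcup. Qed.

(* The sigma-algebra generated by the coordinates, as the library does for
   [n.-tuple T]; it is the Borel sigma-algebra of ['rV[R]_n]. *)
HB.instance Definition _ := @isMeasurable.Build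
  (rV_display (R.-ocitv.-measurable).-sigma)
  'rV[R]_n (g_sigma_preimage coors) rV_set0 rV_setC rV_bigcup.

End measurable_rV.

Section lebesgue_rV.
Context (R : realType).

Definition rV_cons n (p : measurableTypeR R * 'rV[R]_n) : 'rV[R]_n.+1 :=
  \row_i oapp (p.2 ord0) p.1 (unlift ord0 i).

Definition rV_uncons n (x : 'rV[R]_n.+1) : measurableTypeR R * 'rV[R]_n :=
  (x ord0 ord0, \row_i x ord0 (lift ord0 i)).

Lemma rV_cons0 n p : @rV_cons n p ord0 ord0 = p.1.
Proof. by rewrite mxE unlift_none. Qed.

Lemma rV_consS n p i : @rV_cons n p ord0 (lift ord0 i) = p.2 ord0 i.
Proof. by rewrite mxE liftK. Qed.

Lemma rV_consK n : cancel (@rV_cons n) (@rV_uncons n).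
Proof.
case=> a x; rewrite /rV_uncons rV_cons0; congr pair.
by apply/rowP => i; rewrite mxE rV_consS.
Qed.

Lemma measurable_rV_coord n (i : 'I_n) :
  measurable_fun [set: 'rV[R]_n] (fun x => x ord0 i : measurableTypeR R).
Proof.
move=> _ Y mY; rewrite setTI; apply: sub_sigma_algebra => /=.
rewrite -bigcup_seq/=; exists i => /=; first by rewrite mem_index_enum.
by exists Y => //; rewrite setTI.
Qed.

Lemma measurable_rVP d (T : measurableType d) n (f : T -> 'rV[R]_n) :
  (forall i, measurable_fun setT (fun t => f t ord0 i : measurableTypeR R)) ->
  measurable_fun setT f.
Proof.
move=> mf.
pose c (i : 'I_n) (x : 'rV[R]_n) : measurableTypeR R := x ord0 i.
suff: g_sigma_preimage (fun i => c i \o f) `<=` measurable.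
  by rewrite g_sigma_preimage_comp => H _ A mA; rewrite setTI; apply: H;
    exists A => //; rewrite setTI.
apply: smallest_sub; first exact: sigma_algebra_measurable.
case: n => [|n] in f mf c *; first by rewrite big_ord0.
rewrite -bigcup_mkord_ord; apply: bigcup_sub => i Ii.
by move=> A [B mB <-]; exact: mf.
Qed.

Lemma measurable_rV_cons n : measurable_fun setT (@rV_cons n).
Proof.
apply: measurable_rVP => i; case: (unliftP ord0 i) => [j ->|->].
  under eq_fun do rewrite rV_consS.
  exact: (measurableT_comp (measurable_rV_coord j) measurable_snd).
by under eq_fun do rewrite rV_cons0; exact: measurable_fst.
Qed.

Lemma measurable_rV_uncons n : measurable_fun setT (@rV_uncons n).
Proof.
apply/measurable_fun_pairP; split; first exact: measurable_rV_coord.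
apply: measurable_rVP => i; under eq_fun do rewrite /= mxE.
exact: measurable_rV_coord.
Qed.

Section lebesgue_rV_step.
Context (n : nat) (m : {sigma_finite_measure set 'rV[R]_n -> \bar R}).

Let step : set 'rV[R]_n.+1 -> \bar R :=
  pushforward (lebesgue_measure \x m)%E (@rV_cons n).

Let step0 : step set0 = 0%E.
Proof. by rewrite /step /pushforward preimage_set0 measure0. Qed.

Let step_ge0 A : (0 <= step A)%E.
Proof. by rewrite /step /pushforward; exact: measure_ge0. Qed.

Let step_sigma_additive : semi_sigma_additive step.
Proof.
have mcons A : measurable A -> measurable (@rV_cons n @^-1` A).
  by move=> mA; rewrite -[X in measurable X]setTI; exact: measurable_rV_cons.
move=> F mF tF mUF; rewrite /step /pushforward preimage_bigcup.
apply: measure_semi_sigma_additive.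
- by move=> i; exact: mcons.
- apply/trivIsetP => /= i j _ _ ij; rewrite -preimage_setI.
  by move/trivIsetP : tF => /(_ _ _ _ _ ij) ->//; rewrite preimage_set0.
- by rewrite -preimage_bigcup; exact: mcons.
Qed.

HB.instance Definition _ := isMeasure.Build _ _ _ step
  step0 step_ge0 step_sigma_additive.

Let step_sigma_finite : sigma_finite setT step.
Proof.
have [F TF Foo] : sigma_finite setT (lebesgue_measure \x m)%E.
  have /sigma_finiteP[F [TF ndF Foo]] := sigma_finiteT (@lebesgue_measure R).
  have /sigma_finiteP[G [TG ndG Goo]] := sigma_finiteT m.
  exists (fun i => F i `*` G i).
    rewrite -setXTT TF TG predeqE => -[x y]; split; last first.
      by move=> [i _ []/= ? ?]; split; exists i.
    move=> [/= [i _ Fix] [j _ Gjy]]; exists (maxn i j) => //; split.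
    - by move: x Fix; exact/subsetPset/ndF/leq_maxl.
    - by move: y Gjy; exact/subsetPset/ndG/leq_maxr.
  move=> i; have [? ?] := Foo i; have [? ?] := Goo i.
  split; first exact: measurableX.
  by rewrite product_measure1E// lte_mul_pinfty// ge0_fin_numE.
exists (fun i => @rV_uncons n @^-1` F i).
  by rewrite -preimage_bigcup -TF preimage_setT.
move=> i; have [mF Fi] := Foo i; split.
  by rewrite -[X in measurable X]setTI; exact: measurable_rV_uncons.
rewrite /step /pushforward -comp_preimage.
rewrite [X in X @^-1` _](_ : _ = id)// funeqE => p /=.
by rewrite rV_consK.
Qed.

HB.instance Definition _ := Measure_isSigmaFinite.Build _ _ _ step
  step_sigma_finite.

Definition lebesgue_rV_step :
  {sigma_finite_measure set 'rV[R]_n.+1 -> \bar R} := step.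

End lebesgue_rV_step.

Fixpoint lebesgue_rV n : {sigma_finite_measure set 'rV[R]_n -> \bar R} :=
  match n with
  | 0 => dirac (0 : 'rV[R]_0)
  | m.+1 => lebesgue_rV_step (lebesgue_rV m)
  end.

Lemma lebesgue_rV_box n (A : 'I_n -> set (measurableTypeR R)) :
  (forall i, measurable (A i)) ->
  lebesgue_rV n [set x | forall i, A i (x ord0 i)]
    = (\prod_(i < n) lebesgue_measure (A i))%E.
Proof.
elim: n A => [|n IHn] A mA.
  rewrite big_ord0 /= diracE (_ : _ \in _ = true)//.
  by apply/mem_set => -[].
rewrite big_ord_recl -IHn//.
have mB : measurable [set x : 'rV[R]_n | forall i, A (lift ord0 i) (x ord0 i)].
  have -> : [set x : 'rV[R]_n | forall i, A (lift ord0 i) (x ord0 i)] =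
      \bigcap_(i in [set: 'I_n]) ((fun x : 'rV[R]_n =>
        x ord0 i : measurableTypeR R) @^-1` A (lift ord0 i)).
    by apply/seteqP; split => x /= H i; [move=> _|]; exact: H.
  apply: fin_bigcap_measurable => // i _.
  by rewrite -[X in measurable X]setTI; exact: measurable_rV_coord.
rewrite -product_measure1E//.
rewrite [LHS](_ : _ = (lebesgue_measure \x lebesgue_rV n)%E
  (@rV_cons n @^-1` [set x | forall i, A i (x ord0 i)]))//.
congr (_ _); apply/seteqP; split => -[a x] /= H.
  by split=> [|i]; [have := H ord0; rewrite rV_cons0|
                    have := H (lift ord0 i); rewrite rV_consS].
case: H => Ha Hx i; case: (unliftP ord0 i) => [j ->|->].
  by rewrite rV_consS; exact: Hx.
by rewrite rV_cons0.
Qed.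

End lebesgue_rV.

Section domains.
Context (R : realType) (n : nat).

(* The library norm on ['rV[R]_n] is the sup norm. *)
Definition eucl_norm (x : 'rV[R]_n) : R := Num.sqrt (\sum_i x ord0 i ^+ 2).

(* Near each boundary point, after a rigid motion [x |-> (x - x0) *m Q], [Om] is
   the region above the graph of a Lipschitz function of the coordinates other
   than the [i]-th. *)
Definition lipschitz_boundary (Om : set 'rV[R]_n) : Prop :=
  forall x0, (closure Om `\` interior Om) x0 ->
  exists (Q : 'M[R]_n) (i : 'I_n) (phi : 'rV[R]_n.-1 -> R^o) (r : R),
    [/\ Q *m Q^T = 1%:M, lipschitz phi, 0 < r &
      forall x, eucl_norm (x - x0) < r ->
        let y := (x - x0) *m Q in Om x <-> phi (col' i y) < y ord0 i].

End domains.

Section young.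
Context (R : realType).
Implicit Types g G : R -> R.

(* Only the values of [g] and [G] on [0, +oo[ matter. Since [g] need only be
   right continuous, [g = G'] is the right derivative (it follows from the
   integral formula, which also gives the two-sided one off a countable set). *)
Record young_function g G : Prop := YoungFunction {
  young_integral : forall t, 0 <= t ->
    (G t)%:E = (\int[lebesgue_measure]_(tau in `[0%R, t]) (g tau)%:E)%E ;
  young_right_continuous : forall t, 0 <= t -> g x @[x --> t^'+] --> g t ;
  young_nondecreasing : {in `[0, +oo[ &, {homo g : x y / x <= y}} ;
  young_at0 : g 0 = 0 ;
  young_gt0 : forall t, 0 < t -> 0 < g t ;
  young_at_infty : g x @[x --> +oo] --> +oo ;
  young_derivative : forall t, 0 <= t ->
    (G (t + h) - G t) / h @[h --> 0^'+] --> g t }.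

Definition young_inverse G : R -> R := 'pinv_(fun=> 0) `[0, +oo[ G.

End young.

Section problems.
Context (R : realType) (n : nat) (s : R) (g G : R -> R).
Context (Om : set 'rV[R]_n) (beta : 'rV[R]_n -> R).
Local Notation V := 'rV[R]_n.
Local Notation leb := (lebesgue_rV R n).
Local Notation leb2 := (lebesgue_rV R n \x lebesgue_rV R n)%E.
Implicit Types (u v : V -> R) (D : set V) (E : set (V * V)).
Implicit Types (mu lambda : R).

Definition Ds u (x y : V) : R := (u x - u y) / eucl_norm (x - y) `^ s.

(* density of the measure written dmu = dx dy / |x - y|^n; on the diagonal, a
   null set for n > 0, its value is [0] since [0^-1 = 0] *)
Definition kern (x y : V) : R := (eucl_norm (x - y) ^+ n)^-1.

Definition offOmc2 : set (V * V) := ~` ((~` Om) `*` (~` Om)).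

Definition gsgn (r : R) : R := g `|r| * (r / `|r|).

Local Open Scope ereal_scope.

Definition Phi D u : \bar R := \int[leb]_(x in D) (G `|u x|)%:E.

Definition Phis E u : \bar R :=
  \int[leb2]_(p in E) (G `|Ds u p.1 p.2| * kern p.1 p.2)%:E.

Definition Phi_beta u : \bar R :=
  \int[leb]_(x in ~` Om) (beta x * G `|u x|)%:E.

(* Functions are identified when equal almost everywhere; elements of the
   spaces are Borel representatives. *)
Definition W0 : set (V -> R) := [set u |
  [/\ measurable_fun setT u, Phi setT u < +oo, Phis setT u < +oo &
      \forall x \ae leb, (~` Om) x -> u x = 0%R]].

Definition Wstar : set (V -> R) := [set u |
  [/\ measurable_fun setT u, Phi Om u < +oo & Phis offOmc2 u < +oo]].

(* A function on [Om] is represented by any extension to the whole space: only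
   its values on [Om] are used. *)
Definition Wreg : set (V -> R) := [set u |
  [/\ measurable_fun Om u, Phi Om u < +oo & Phis (Om `*` Om) u < +oo]].

Definition Xbeta : set (V -> R) := [set u | Wstar u /\ Phi_beta u < +oo].

Definition quotD u := (Phis setT u + Phi Om u) / Phi Om u.
Definition quotN u := (Phis offOmc2 u + Phi Om u) / Phi Om u.
Definition quotNreg u := (Phis (Om `*` Om) u + Phi Om u) / Phi Om u.
Definition quotR u := (Phis offOmc2 u + Phi Om u + Phi_beta u) / Phi Om u.

Definition admissible (W : set (V -> R)) mu : set (V -> R) :=
  [set u | W u /\ Phi Om u = mu%:E].

Definition LambdaD mu := ereal_inf (quotD @` admissible W0 mu).
Definition LambdaN mu := ereal_inf (quotN @` admissible Wstar mu).
Definition LambdaNreg mu := ereal_inf (quotNreg @` admissible Wreg mu).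
Definition LambdaR mu := ereal_inf (quotR @` admissible Xbeta mu).

Definition attainsD mu u := admissible W0 mu u /\ quotD u = LambdaD mu.
Definition attainsN mu u := admissible Wstar mu u /\ quotN u = LambdaN mu.
Definition attainsNreg mu u := admissible Wreg mu u /\ quotNreg u = LambdaNreg mu.
Definition attainsR mu u := admissible Xbeta mu u /\ quotR u = LambdaR mu.

Definition formE E u v : \bar R :=
  \int[leb2]_(p in E) (gsgn (Ds u p.1 p.2) * Ds v p.1 p.2 * kern p.1 p.2)%:E.

Definition form_Om u v : \bar R := \int[leb]_(x in Om) (gsgn (u x) * v x)%:E.

Definition form_beta u v : \bar R :=
  \int[leb]_(x in ~` Om) (beta x * gsgn (u x) * v x)%:E.

Definition eigenD lambda u := W0 u /\
  forall v, W0 v -> formE setT u v = (lambda - 1)%:E * form_Om u v.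

Definition eigenN lambda u := Wstar u /\
  forall v, Wstar v -> formE offOmc2 u v = (lambda - 1)%:E * form_Om u v.

Definition eigenNreg lambda u := Wreg u /\
  forall v, Wreg v -> formE (Om `*` Om) u v = (lambda - 1)%:E * form_Om u v.

Definition eigenR lambda u := Xbeta u /\
  forall v, Xbeta v ->
    formE offOmc2 u v = (lambda - 1)%:E * form_Om u v - form_beta u v.

End problems.

(* Main.v *)
Require Import Defs.
From mathcomp Require Import all_boot all_order all_algebra.
From mathcomp Require Import all_classical all_reals all_analysis measurable_realfun.
Set Implicit Arguments.
Unset Strict Implicit.
Unset Printing Implicit Defensive.
Import Order.TTheory GRing.Theory Num.Theory.
Import numFieldNormedType.Exports.
Local Open Scope classical_set_scope.
Local Open Scope ring_scope.

(** Testing the weak equation with the eigenfunction [u] itself makes every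
form sign definite. The nonlinearity [gsgn] is odd and nonnegative on
nonnegative numbers, so [gsgn r * r >= 0] and the nonlocal form at [(u, u)] is
nonnegative, whatever the domain of integration; the boundary form of the Robin
problem is nonnegative because [beta > 0] almost everywhere. On the right-hand
side [lambda - 1] multiplies the integral over [Om] of [g(|u|) |u|]. As
[t g(t) / G(t) >= pm > 1], this integral dominates that of [G(|u|)], which is
the prescribed [mu > 0]. Hence [lambda < 1] would equate a nonnegative quantity
with a negative one, and the constant [1] is a lower bound for all the
eigenvalues and all [mu].

Comparing integrals on their definition as suprema over simple functions, and
signs in the extended reals, spares a proof that the integrands are measurable
and the forms finite. *)

Import HBNNSimple.

Section integral_without_measurability.
Local Open Scope ereal_scope.
Context d (T : measurableType d) (R : realType) (mu : {measure set T -> \bar R}).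
Implicit Types (D : set T) (f g : T -> \bar R).

(** Every simple function below [f] is below [g], so the supremum defining the
integral grows even when [f], [g] or [D] is not measurable. *)
Lemma ge0_le_integral_nonmeasurable D f g :
  (forall x, D x -> 0 <= f x) -> (forall x, D x -> f x <= g x) ->
  \int[mu]_(x in D) f x <= \int[mu]_(x in D) g x.
Proof.
move=> f0 fg.
have g0 x : D x -> 0 <= g x by move=> Dx; exact: le_trans (f0 _ Dx) (fg _ Dx).
rewrite !ge0_integralE//; apply: le_ereal_sup => _ [h /= hf <-].
exists h => //= x; apply: le_trans (hf x) _.
exact: lee_restrict.
Qed.

(** A simple function below a function that vanishes almost everywhere vanishes
almost everywhere too, and simple functions are measurable. *)
Lemma ae_eq0_ge0_integral_nonmeasurable f :
  (forall x, 0 <= f x) -> (\forall x \ae mu, f x = 0) ->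
  \int[mu]_x f x = 0.
Proof.
move=> f0 fae; apply/eqP; rewrite eq_le integral_ge0// andbT ge0_integralTE//.
apply: ge_ereal_sup => _ [h /= hf <-].
rewrite -integralT_nnsfun (ae_eq_integral (cst 0))//.
- by rewrite integral0.
- by apply/measurable_EFinP.
- apply: filterS fae => x fx0 _; apply/eqP => /=.
  by rewrite eq_le -{1}fx0 hf/= lee_fin fun_ge0.
Qed.

(** The integral of the negative part is zero, and subtracting zero from the
integral of the positive part leaves a nonnegative value, finite or not. *)
Lemma ae_integral_ge0_nonmeasurable D f :
  (\forall x \ae mu, D x -> 0 <= f x) -> 0 <= \int[mu]_(x in D) f x.
Proof.
move=> fae; rewrite integralE [X in _ - X]integral_mkcond.
rewrite (ae_eq0_ge0_integral_nonmeasurable (f := f^\- \_ D)).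
- by rewrite sube0; apply: integral_ge0.
- exact: erestrict_ge0.
- apply: filterS fae => x fx; rewrite patchE.
  case: ifPn => // /set_mem /fx fx0.
  by rewrite funenegE; apply/max_idPr; rewrite oppe_le0.
Qed.

End integral_without_measurability.

Section young_pointwise.
Context (R : realType) (g G : R -> R) (Gg : young_function g G).

Lemma young_ge0 t : 0 <= t -> 0 <= g t.
Proof.
rewrite le_eqVlt => /predU1P[<-|t0]; first by rewrite (young_at0 Gg).
exact/ltW/(young_gt0 Gg).
Qed.

Lemma young_primitive_at0 : G 0 = 0.
Proof.
apply: EFin_inj; rewrite (young_integral Gg)// set_itv1.
by rewrite integral_set1.
Qed.

Lemma young_primitive_ge0 t : 0 <= t -> 0 <= G t.
Proof.
move=> t0; rewrite -lee_fin (young_integral Gg)//; apply: integral_ge0 => x /=.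
by rewrite in_itv/= lee_fin => /andP[x0 _]; exact: young_ge0.
Qed.

Lemma gsgn_mul_self r : gsgn g r * r = g `|r| * `|r|.
Proof.
rewrite /gsgn; have [->|r0] := eqVneq r 0; first by rewrite normr0 !mulr0.
rewrite -mulrA; congr (_ * _).
by rewrite mulrAC -expr2 -real_normK ?num_real// expr2 mulfK// normr_eq0.
Qed.

Lemma gsgn_mul_self_ge0 r : 0 <= gsgn g r * r.
Proof. by rewrite gsgn_mul_self mulr_ge0// young_ge0. Qed.

(** The lower growth exponent exceeds [1], so [G t < t * g t] wherever
[G t > 0]. *)
Lemma young_primitive_le_gsgn pm :
  1 < pm -> (forall t, 0 < t -> pm <= t * g t / G t) ->
  forall r, G `|r| <= gsgn g r * r.
Proof.
move=> pm1 growth r; rewrite gsgn_mul_self.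
have [->|r0] := eqVneq r 0.
  by rewrite normr0 young_primitive_at0 mulr0.
have nr0 : 0 < `|r| by rewrite normr_gt0.
have := young_primitive_ge0 (ltW nr0).
rewrite le_eqVlt => /predU1P[<-|G0]; first by rewrite mulr_ge0// young_ge0.
have := lt_le_trans pm1 (growth _ nr0).
by rewrite ltr_pdivlMr// mul1r => /ltW; rewrite mulrC.
Qed.

End young_pointwise.

Section forms_on_the_diagonal.
Context (R : realType) (n : nat) (s : R) (g G : R -> R) (Gg : young_function g G).
Local Open Scope ereal_scope.
Implicit Types (u : 'rV[R]_n -> R) (Om : set 'rV[R]_n).

Lemma formE_self_ge0 (E : set ('rV[R]_n * 'rV[R]_n)) u : 0 <= formE s g E u u.
Proof.
apply: integral_ge0 => p _; rewrite lee_fin mulr_ge0 ?(gsgn_mul_self_ge0 Gg)//.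
by rewrite invr_ge0 exprn_ge0// sqrtr_ge0.
Qed.

Lemma form_beta_self_ge0 Om (beta : 'rV[R]_n -> R) u :
  (\forall x \ae lebesgue_rV R n, (~` Om)%classic x -> (0 < beta x)%R) ->
  0 <= form_beta g Om beta u u.
Proof.
move=> beta_gt0; apply: ae_integral_ge0_nonmeasurable.
apply: filterS beta_gt0 => x beta_x /beta_x bx.
by rewrite lee_fin -mulrA mulr_ge0 ?(gsgn_mul_self_ge0 Gg)// ltW.
Qed.

Lemma Phi_le_form_Om_self pm Om u :
  (1 < pm)%R -> (forall t, (0 < t)%R -> (pm <= t * g t / G t)%R) ->
  Phi G Om u <= form_Om g Om u u.
Proof.
move=> pm1 growth; apply: ge0_le_integral_nonmeasurable => x _; rewrite lee_fin.
  exact: young_primitive_ge0 Gg _ _.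
exact: young_primitive_le_gsgn pm1 growth _.
Qed.

End forms_on_the_diagonal.

(** The three problems without boundary form are the case [b = 0]. Infinite
values are harmless: for [lambda < 1] the right-hand side is a negative
extended real minus a nonnegative one. *)
Lemma ge1_of_energy_identity (R : realType) (lambda : R) (a b F : \bar R) :
  (0 <= a)%E -> (0 <= b)%E -> (0 < F)%E -> (a = (lambda - 1)%:E * F - b)%E ->
  1 <= lambda.
Proof.
move=> a0 b0 F0 eq_a.
rewrite leNgt; apply/negP => lambda1.
suff : (a < 0)%E by rewrite ltNge a0.
rewrite eq_a; apply: le_lt_trans (_ : (lambda - 1)%:E * F < 0)%E.
  by rewrite -[leRHS]sube0 leeB.
by rewrite mule_lt0_gt0// lte_fin subr_lt0.
Qed.

Theorem theorem5p9 (R : realType) (n : nat) (s : R) (g G : R -> R)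
    (pm pp : R) (Om : set 'rV[R]_n) (beta : 'rV[R]_n -> R)
  (n_gt0 : (0 < n)%N)
  (s01 : 0 < s < 1)
  (Om_open : open Om)
  (Om_bounded : bounded_set Om)
  (Om_lipschitz : lipschitz_boundary Om)
  (beta_measurable : measurable_fun (~` Om) beta)
  (beta_bounded : exists M : R,
    \forall x \ae lebesgue_rV R n, (~` Om) x -> `|beta x| <= M)
  (beta_gt0 : \forall x \ae lebesgue_rV R n, (~` Om) x -> 0 < beta x)
  (G_young : young_function g G)
  (pm_gt1 : 1 < pm)
  (G_growth : forall t, 0 < t -> pm <= t * g t / G t <= pp)
  (G_sqrt_convex : convex_function (`[0, +oo[ : set R)
    (fun t => G (Num.sqrt t)))
  (Ginv_near0 : (\int[lebesgue_measure]_(tau in `[0%R, 1%R])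
    (young_inverse G tau / tau `^ ((n%:R + s) / n%:R))%:E < +oo)%E)
  (Ginv_near_infty : (\int[lebesgue_measure]_(tau in `[1%R, +oo[)
    (young_inverse G tau / tau `^ ((n%:R + s) / n%:R))%:E = +oo)%E) :
  exists c : R, 0 < c /\
    forall mu : R, 0 < mu ->
    forall lambdaD lambdaR lambdaN lambdaNreg : R,
      [/\ (exists uD, attainsD s G Om mu uD /\ eigenD s g G Om lambdaD uD) ->
            c <= lambdaD,
          (exists uR, attainsR s G Om beta mu uR /\
            eigenR s g G Om beta lambdaR uR) -> c <= lambdaR,
          (exists uN, attainsN s G Om mu uN /\ eigenN s g G Om lambdaN uN) ->
            c <= lambdaN &
          (exists uNreg, attainsNreg s G Om mu uNreg /\
            eigenNreg s g G Om lambdaNreg uNreg) -> c <= lambdaNreg].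
Proof.
have growth t : 0 < t -> pm <= t * g t / G t by move=> /G_growth/andP[].
exists 1; split=> // mu mu_gt0 lambdaD lambdaR lambdaN lambdaNreg.
have form_Om_gt0 u : Phi G Om u = mu%:E -> (0 < form_Om g Om u u)%E.
  move=> Phi_u; apply: lt_le_trans (Phi_le_form_Om_self G_young _ _ pm_gt1 growth).
  by rewrite Phi_u lte_fin.
split.
- move=> [u [[[_ /form_Om_gt0 F0] _] [Wu /(_ _ Wu) eq_u]]].
  by apply: (ge1_of_energy_identity (formE_self_ge0 s G_young setT u)
    (lexx 0%E) F0); rewrite eq_u sube0.
- move=> [u [[[_ /form_Om_gt0 F0] _] [Wu /(_ _ Wu) eq_u]]].
  exact: (ge1_of_energy_identity (formE_self_ge0 s G_young (offOmc2 Om) u)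
    (form_beta_self_ge0 G_young u beta_gt0) F0 eq_u).
- move=> [u [[[_ /form_Om_gt0 F0] _] [Wu /(_ _ Wu) eq_u]]].
  by apply: (ge1_of_energy_identity (formE_self_ge0 s G_young (offOmc2 Om) u)
    (lexx 0%E) F0); rewrite eq_u sube0.
- move=> [u [[[_ /form_Om_gt0 F0] _] [Wu /(_ _ Wu) eq_u]]].
  by apply: (ge1_of_energy_identity (formE_self_ge0 s G_young (Om `*` Om) u)
    (lexx 0%E) F0); rewrite eq_u sube0.
Qed.
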